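(* Consider the system, data sets and quantities defined in the context, and suppose that: (1) the system is asymptotically stable; (2) $|d_i(k)|\le \bar d_{0_i}$ for all $k\in\mathbb{Z}$ and all $i$, and $u(k)\in\mathbb{U}$ for all $k\in\mathbb{Z}$ with $\mathbb{U}\subset\mathbb{R}^m$ compact; (3) the system is fully observable and reachable; (4) the model order satisfies $o\ge n$; (5) for any $\beta>0$ there exists $N<\infty$ such that $d_2\big(\mathscr{V}_{i_p},\tilde{\mathscr{V}}_{i_p}^N\big)\le\beta$. Suppose further that the chosen value of $\bar p\in\mathbb{N}$, $\bar p\ge2$, satisfies $o\hat L_i\hat\rho_i^{\bar p+1}<1$. Let $\theta_{i_1}\in\mathbb{R}^{o(m+1)}$ be a generic parameter vector. If $$h_{p,o}(\theta_{i_1})\in\Gamma_{i_p}\quad\text{for all } p\in[2,\bar p],$$ then the corresponding ARX model $\hat z_i(k+1)=\varphi_{i_1}(k)^T\theta_{i_1}$ is asymptotically stable.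
   Context: System: the discrete-time LTI system $x(k+1)=Ax(k)+Bu(k)$, $z(k)=Cx(k)$, with $x(k)\in\mathbb{R}^n$, $u(k)\in\mathbb{R}^m$, $z(k)\in\mathbb{R}^q$, $k\in\mathbb{Z}$; measured output $y(k)=z(k)+d(k)$ with noise $d(k)\in\mathbb{R}^q$. Subscript $i$ denotes the $i$-th component. $\bar d_{0_i}$ is the true bound on $|d_i|$, $\bar d_i$ an estimate of it, $o\in\mathbb{N}$ the model order. Model: for a horizon $p$, $\varphi_{i_p}(k)=[y_i(k),\dots,y_i(k-o+1),\,u(k+p-1)^T,\dots,u(k)^T,\dots,u(k-o+1)^T]^T\in\mathbb{R}^{o+m(o+p-1)}$. The one-step-ahead ARX model is $\hat z_i(k+1)=\varphi_{i_1}(k)^T\theta_{i_1}$. Iterating it $p$ times (predicted outputs replacing future measured ones) gives $\hat z_i(k+p)=\varphi_{i_p}(k)^T\theta_{i_p}$ with $\theta_{i_p}=h_{p,o}(\theta_{i_1})$, which defines the polynomial map $h_{p,o}:\mathbb{R}^{o(m+1)}\to\mathbb{R}^{o+m(o+p-1)}$. Write $\theta_{i_p}=[\theta_{i_{p,z}}^T,\theta_{i_{p,u}}^T]^T$, with $\theta_{i_{p,z}}\in\mathbb{R}^o$ the output coefficients and $\theta_{i_{p,u}}\in\mathbb{R}^{m(o+p-1)}$ the input coefficients; $^{(l)}$ denotes the $l$-th entry. Asymptotic stability of the ARX model is meant for its simulation recursion (past model outputs fed back in place of measured outputs): with zero input, every solution of $\hat z_i(k+1)=\sum_{l=1}^o\theta_{i_{1,z}}^{(l)}\hat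 z_i(k-l+1)$ tends to zero, equivalently all roots of $s^o-\sum_{l=1}^o\theta_{i_{1,z}}^{(l)}s^{o-l}$ lie in the open unit disk. Regressor sets and data: the noise-free version of $\varphi_{i_p}(k)$ (with $z_i$ in place of $y_i$) takes values in a compact set $\Psi_{i_{p_o}}$, and $\varphi_{i_p}(k)\in\Phi_{i_p}=\Psi_{i_{p_o}}\oplus\mathbb{D}_{i_p}$ (Minkowski sum), where $\mathbb{D}_{i_p}=\{[d_i^{(1)},\dots,d_i^{(o)},0,\dots,0]^T: |d_i^{(l)}|\le\bar d_{0_i}\}$. $\tilde{\mathscr{V}}_{i_p}^N=\{[\tilde\varphi_{i_p}(k)^T,\tilde y_{i_p}(k)]^T:\ k=1,\dots,N\}$ is the set of $N$ measured pairs, $\tilde y_{i_p}(k)=\tilde y_i(k+p)$; $\mathscr{V}_{i_p}=\{[\varphi_{i_p}^T,y_{i_p}]^T:\ y_{i_p}\in Y_{i_p}(\varphi_{i_p}),\ \varphi_{i_p}\in\Phi_{i_p}\}$, where $Y_{i_p}(\varphi_{i_p})$ is the compact set of all possible output values corresponding to $\varphi_{i_p}$ and every noise realization with $|d_i|\le\bar d_{0_i}$; $d_2(\mathscr{V}_{i_p},\tilde{\mathscr{V}}_{i_p}^N)=\max_{v_1\in\mathscr{V}_{i_p}}\min_{v_2\in\tilde{\mathscr{V}}_{i_p}^N}\|v_2-v_1\|_2$. Decay estimates: let $\underline\lambda_{i_p}$ be the minimum of $\lambda\ge0$ over $\lambda$ and $\theta_{i_p}\in\Omega_p$ subject to $|\tilde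 y_{i_p}-\tilde\varphi_{i_p}^T\theta_{i_p}|\le\lambda+\bar d_i$ for all data in $\tilde{\mathscr{V}}_{i_p}^N$, where $\Omega_p$ is a (very large) compact approximation of $\mathbb{R}^{o+m(o+p-1)}$. $\hat L_i>0$ and $\hat\rho_i\in(0,1)$ are estimated decay parameters: for a horizon $\bar p_i$, $(L_i',\hat\rho_i)$ minimizes $\sum_{p=1}^{\bar p_i}(\underline\lambda_{i_p}-L_i'\hat\rho_i^{p+1})^2$ subject to $L_i'\hat\rho_i^{p+1}\ge\underline\lambda_{i_p}$ for $p=1,\dots,\bar p_i$, $L_i'>0$, $0<\hat\rho_i<1$; and $\hat L_i=L_i'/(o\bar d_i)$. Here $\bar p_i$ is the smallest horizon such that $\underline\lambda_{i_p}<\delta$ for all $p\ge\bar p_i$, with $\delta\approx0$ a tolerance. Decay set: $\Gamma_{i_p}=\{\theta_{i_p}:\ |\theta_{i_{p,z}}^{(l)}|\le\hat L_i\hat\rho_i^{p+l},\ l\in[1,o],\ \text{and}\ |\theta_{i_{p,u}}^{(l)}|\le\hat L_i\hat\rho_i^{\lceil l/m\rceil},\ l\in[1,m(o+p-1)]\}$. *)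

(* Defs.v *)
From HB Require Import structures.
From mathcomp Require Import all_boot all_order all_algebra.
From mathcomp Require Import all_classical all_reals all_analysis.
From mathcomp Require Import zify.
Set Implicit Arguments.
Unset Strict Implicit.
Unset Printing Implicit Defensive.
Import Order.TTheory GRing.Theory Num.Theory.
Import numFieldNormedType.Exports.
Local Open Scope classical_set_scope.
Local Open Scope ring_scope.

Definition is_min (disp : Order.disp_t) (T : porderType disp)
  (S : set T) (x : T) : Prop := S x /\ lbound S x.

Definition dot (R : realType) (n : nat) (v w : 'cV[R]_n) : R :=
  (v^T *m w) 0 0.

Definition norm2 (R : realType) (n : nat) (v : 'cV[R]_n) : R :=
  Num.sqrt (\sum_(j < n) v j 0 ^+ 2).

(* The outer maximum and the inner minimum are taken as supremum and infimum
   in the extended reals, so that an unattained or infinite value is not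
   replaced by a default. *)
Definition d2 (R : realType) (n : nat) (V W : set 'cV[R]_n) : \bar R :=
  ereal_sup [set ereal_inf [set (norm2 (v2 - v1))%:E | v2 in W] | v1 in V].

Section System.
Context {R : realType} {n m q : nat}.
Implicit Types (A : 'M[R]_n) (B : 'M[R]_(n, m)) (C : 'M[R]_(q, n)).

Fixpoint state A B (x0 : 'cV[R]_n) (u : nat -> 'cV[R]_m) (k : nat) : 'cV[R]_n :=
  if k is j.+1 then A *m state A B x0 u j + B *m u j else x0.

(* Attractivity of the origin with zero input; in finite dimension, for a linear
   system, it entails stability in the sense of Lyapunov. *)
Definition asymptotically_stable A B : Prop :=
  forall x0, state A B x0 (fun=> 0) @ \oo --> (0 : 'cV[R]_n).

Definition reachable A B : Prop :=
  forall xf, exists T, exists u, state A B 0 u T = xf.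

Definition observable A B C : Prop :=
  forall u x0 x0',
    (forall k, C *m state A B x0 u k = C *m state A B x0' u k) -> x0 = x0'.

Definition trajectory A B (x : int -> 'cV[R]_n) (u : int -> 'cV[R]_m) : Prop :=
  forall k, x (k + 1) = A *m x k + B *m u k.

Definition noise_bounded (dbar0 : 'I_q -> R) (d : int -> 'cV[R]_q) : Prop :=
  forall k j, `|d k j 0| <= dbar0 j.

Definition perf C (i : 'I_q) (x : int -> 'cV[R]_n) (k : int) : R :=
  (C *m x k) i 0.

Definition meas C (i : 'I_q) (x : int -> 'cV[R]_n) (d : int -> 'cV[R]_q)
  (k : int) : R := (C *m x k + d k) i 0.

End System.

(* Length of the [p]-step regressor; meant for [1 <= p], where the truncated
   subtraction is exact. For [p = 1] it equals [o * (m + 1)]. *)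
Notation rdim m o p := (o + m * (o + p - 1))%N.

Fact comp_subproof (m c : nat) (l : 'I_(m * c)) : (l %% m < m)%N.
Proof. by rewrite ltn_pmod //; case: m l => [|//] [l]; rewrite mul0n. Qed.

Definition comp (m c : nat) (l : 'I_(m * c)) : 'I_m :=
  Ordinal (comp_subproof l).

Section Arx.
Context {R : realType} {m o : nat}.
Implicit Types (y : int -> R) (u : int -> 'cV[R]_m) (k : int) (p : nat).

(* [y(k), ..., y(k-o+1), u(k+p-1)^T, ..., u(k-o+1)^T]^T; entry [l] (from 0) of
   the input part lies in the block [u(k+p-1 - l %/ m)], at component
   [l %% m]. *)
Definition regressor p y u k : 'cV[R]_(rdim m o p) :=
  col_mx (\col_(l < o) y (k - l%:Z))
         (\col_(l < m * (o + p - 1))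
            u (k + p%:Z - 1 - (l %/ m)%N%:Z) (comp l) 0).

Implicit Type th : 'cV[R]_(rdim m o 1).

(* The output signal after [p] one-step-ahead predictions from time [k]: its
   values at times [k+1, ..., k+p] are the predicted ones. *)
Fixpoint iter_pred th y u k p : int -> R :=
  if p is j.+1 then
    fun t => if t == k + j.+1%:Z
             then dot (regressor 1 (iter_pred th y u k j) u (k + j%:Z)) th
             else iter_pred th y u k j t
  else y.

Definition prediction th y u k p : R := iter_pred th y u k p (k + p%:Z).

(* Signals whose [p]-step regressor at time 0 is the [s]-th unit vector, see
   [regressor_unit]. *)
Definition unit_y p (s : 'I_(rdim m o p)) : int -> R := fun t =>
  if fintype.split s is inl l then (t == - l%:Z)%:R else 0.

Definition unit_u p (s : 'I_(rdim m o p)) : int -> 'cV[R]_m := fun t =>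
  if fintype.split s is inr l
  then (t == p%:Z - 1 - (l %/ m)%N%:Z)%:R *: delta_mx (comp l) 0 else 0.

(* The coefficient vector of the iterated predictor, see [predictionE]. *)
Definition hmap p th : 'cV[R]_(rdim m o p) :=
  \col_s prediction th (unit_y s) (unit_u s) 0 p.

Lemma divmod_inj (c : nat) (l l' : 'I_(m * c)) :
  ((l %/ m)%N == (l' %/ m)%N) && (comp l == comp l') = (l == l').
Proof.
apply/andP/eqP => [[/eqP e1 /eqP e2]|->//].
apply/val_inj; rewrite /= (divn_eq l m) (divn_eq l' m) e1.
by move/(congr1 val): e2 => /= ->.
Qed.

Lemma regressor_unit p (s : 'I_(rdim m o p)) :
  regressor p (unit_y s) (unit_u s) 0 = delta_mx s 0.
Proof.
apply/colP => r; rewrite [RHS]mxE eqxx andbT.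
case: (split_ordP s) => l ->; case: (split_ordP r) => l' ->.
- rewrite /regressor col_mxEu mxE /unit_y (unsplitK (inl l)).
  rewrite (inj_eq (@lshift_inj _ _)) sub0r; congr (_%:R : R).
  by rewrite eqr_opp.
- rewrite /regressor col_mxEd mxE /unit_u (unsplitK (inl l)) mxE.
  by rewrite eq_rlshift.
- rewrite /regressor col_mxEu mxE /unit_y (unsplitK (inr l)).
  by rewrite eq_lrshift.
- rewrite /regressor col_mxEd mxE /unit_u (unsplitK (inr l)) !mxE eqxx andbT.
  rewrite (inj_eq (@rshift_inj _ _)) add0r -natrM mulnb -divmod_inj.
  congr ((_ && _)%:R : R).
  by rewrite (inj_eq (addrI _)) eqr_opp.
Qed.

Lemma dotE c (v w : 'cV[R]_c) : dot v w = \sum_s v s 0 * w s 0.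
Proof. by rewrite /dot mxE; apply: eq_bigr => s _; rewrite mxE. Qed.

Lemma regressor_eq p y y' u u' k k' :
  (forall l : nat, (l < o)%N -> y (k - l%:Z) = y' (k' - l%:Z)) ->
  (forall l : nat, (l < o + p - 1)%N ->
     u (k + p%:Z - 1 - l%:Z) = u' (k' + p%:Z - 1 - l%:Z)) ->
  regressor p y u k = regressor p y' u' k'.
Proof.
move=> ey eu; rewrite /regressor; congr col_mx; apply/colP => l; rewrite !mxE.
  exact: ey.
rewrite eu // ltn_divLR ?(leq_ltn_trans _ (comp_subproof l)) //.
by rewrite [X in (_ < X)%N]mulnC.
Qed.

Lemma iter_pred_shift th y u k p t :
  iter_pred th y u k p (k + t) =
  iter_pred th (fun s => y (k + s)) (fun s => u (k + s)) 0 p t.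
Proof.
elim: p t => [//|p IH] t /=; rewrite add0r (inj_eq (addrI _)) IH.
case: eqP => // _; congr dot; apply: regressor_eq => l _.
  by rewrite -addrA IH add0r.
by congr (u _); lia.
Qed.

Lemma iter_pred_local th y y' u u' p :
  (forall l : nat, (l < o)%N -> y (- l%:Z) = y' (- l%:Z)) ->
  (forall l : nat, (l < o + p - 1)%N ->
     u (p%:Z - 1 - l%:Z) = u' (p%:Z - 1 - l%:Z)) ->
  forall t : int, - o%:Z < t -> t <= p%:Z -> (o == 0)%N ==> (0 < t) ->
  iter_pred th y u 0 p t = iter_pred th y' u' 0 p t.
Proof.
move=> ey; elim: p => [|p IH] eu t t1 t2 t0 /=.
  have -> : t = - (absz t)%:Z by lia.
  by apply: ey; lia.
have eu' (l : nat) : (l < o + p - 1)%N ->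
    u (p%:Z - 1 - l%:Z) = u' (p%:Z - 1 - l%:Z).
  move=> hl; have := eu l.+1.
  have -> : p.+1%:Z - 1 - l.+1%:Z = p%:Z - 1 - l%:Z by lia.
  by apply; lia.
case: eqP => [e|e]; last by apply: IH => //; lia.
congr dot; apply: regressor_eq => l hl.
  by apply: IH => //; lia.
rewrite add0r; have -> : p%:Z + 1 - 1 - l%:Z = p.+1%:Z - 1 - l%:Z by lia.
by apply: eu; lia.
Qed.

Lemma iter_pred_sum th (I : finType) (c : I -> R) (Y : I -> int -> R)
    (W : I -> int -> 'cV[R]_m) k p t :
  iter_pred th (fun t => \sum_s c s * Y s t) (fun t => \sum_s c s *: W s t)
    k p t = \sum_s c s * iter_pred th (Y s) (W s) k p t.
Proof.
elim: p t => [//|p IH] t /=; case: eqP => // _.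
under [RHS]eq_bigr do rewrite dotE mulr_sumr.
rewrite exchange_big dotE /=; apply: eq_bigr => r _.
under [RHS]eq_bigr do rewrite mulrA.
rewrite -mulr_suml; congr (_ * _).
case: (split_ordP r) => l ->; rewrite /regressor.
  by rewrite col_mxEu mxE IH; apply: eq_bigr => s _; rewrite col_mxEu mxE.
rewrite col_mxEd mxE summxE; apply: eq_bigr => s _.
by rewrite col_mxEd !mxE.
Qed.

Lemma regressor_sum p (I : finType) (c : I -> R) (Y : I -> int -> R)
    (W : I -> int -> 'cV[R]_m) k :
  regressor p (fun t => \sum_s c s * Y s t) (fun t => \sum_s c s *: W s t) k
  = \sum_s c s *: regressor p (Y s) (W s) k.
Proof.
apply/colP => r; rewrite summxE.
case: (split_ordP r) => l ->; rewrite /regressor.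
  by rewrite col_mxEu mxE; apply: eq_bigr => s _; rewrite mxE col_mxEu mxE.
rewrite col_mxEd mxE summxE; apply: eq_bigr => s _.
by rewrite [LHS]mxE [RHS]mxE col_mxEd mxE.
Qed.

Lemma prediction_local th y y' u u' k k' p : (0 < p)%N ->
  regressor p y u k = regressor p y' u' k' ->
  prediction th y u k p = prediction th y' u' k' p.
Proof.
move=> p0 /eq_col_mx[/colP ey /colP eu].
rewrite /prediction !iter_pred_shift; apply: iter_pred_local; try lia.
  by move=> l hl; have := ey (Ordinal hl); rewrite !mxE.
move=> l hl; apply/colP => j.
have hlt : (l * m + j < m * (o + p - 1))%N.
  have := ltn_ord j; nia.
have hm : (0 < m)%N by apply: leq_ltn_trans (ltn_ord j).
have := eu (Ordinal hlt); rewrite !mxE /=.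
rewrite divnMDl // (divn_small (ltn_ord j)) addn0 !addrA.
have -> // : comp (Ordinal hlt) = j.
by apply/val_inj; rewrite /= modnMDl modn_small.
Qed.

Lemma predictionE th y u k p : (0 < p)%N ->
  prediction th y u k p = dot (regressor p y u k) (hmap p th).
Proof.
move=> p0; pose c s := regressor p y u k s 0.
rewrite dotE; under eq_bigr do rewrite [hmap _ _ _ _]mxE.
rewrite -iter_pred_sum; apply: (@prediction_local _ y _ u _ k 0 p) => //.
rewrite regressor_sum; under eq_bigr do rewrite regressor_unit.
apply/colP => r; rewrite summxE (bigD1 r) //= big1 => [|s sr].
  by rewrite !mxE !eqxx mulr1 addr0.
by rewrite !mxE eq_sym (negPf sr) mulr0.
Qed.

(* Simulation with zero input from arbitrary past values; entry [l] (from 0)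
   multiplies [zh (k - l)]. *)
Definition arx_stable th : Prop :=
  forall zh : int -> R,
    (forall k, 0 <= k ->
       zh (k + 1) = \sum_(l < o) usubmx th l 0 * zh (k - l%:Z)) ->
    (fun k : nat => zh k%:Z) @ \oo --> (0 : R).

(* The indices [l] start from 0, hence the shifts; [(l.+1 + m - 1) %/ m] is the
   ceiling of [l.+1 / m]. *)
Definition decay_set p (L rho : R) : set 'cV[R]_(rdim m o p) :=
  [set th |
    (forall l : 'I_o, `|usubmx th l 0| <= L * rho ^+ (p + l.+1)) /\
    (forall l : 'I_(m * (o + p - 1)),
       `|dsubmx th l 0| <= L * rho ^+ ((l.+1 + m - 1) %/ m)%N)].

Definition io_point p (phi : 'cV[R]_(rdim m o p)) (yp : R)
  : 'cV[R]_(rdim m o p + 1) := col_mx phi (const_mx yp).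

Definition noise_set p (b : R) : set 'cV[R]_(rdim m o p) :=
  [set v | (forall l : 'I_o, `|usubmx v l 0| <= b) /\ dsubmx v = 0].

Definition noisy_regressors p (Psi : set 'cV[R]_(rdim m o p)) (b : R)
  : set 'cV[R]_(rdim m o p) :=
  [set psi + v | psi in Psi & v in noise_set b].

Definition data_set p y u (N : nat) : set 'cV[R]_(rdim m o p + 1) :=
  [set io_point (regressor p y u k%:Z) (y (k%:Z + p%:Z))
     | k in [set k : nat | (1 <= k <= N)%N]].

Definition error_bounds p (Omega : set 'cV[R]_(rdim m o p))
    (D : set 'cV[R]_(rdim m o p + 1)) (dbar : R) : set R :=
  [set lam | 0 <= lam /\
     exists2 th, Omega th &
       forall v, D v -> `|dsubmx v 0 0 - dot (usubmx v) th| <= lam + dbar].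

End Arx.

Arguments decay_set {R m o} p L rho _.
Arguments data_set {R m o} p y u N _.

Section DecayFit.
Context {R : realType}.
Implicit Types (lam : nat -> R) (rho delta : R) (P : nat).

Definition fit_horizon lam delta P : Prop :=
  is_min [set P' | (1 <= P')%N /\ forall p, (P' <= p)%N -> lam p < delta] P.

Definition fit_feasible lam P (L' : R) rho : Prop :=
  [/\ forall p, (1 <= p <= P)%N -> lam p <= L' * rho ^+ p.+1,
      0 < L' & 0 < rho < 1].

Definition fit_cost lam P (L' : R) rho : R :=
  \sum_(1 <= p < P.+1) (lam p - L' * rho ^+ p.+1) ^+ 2.

Definition fit_optimal lam P (L' : R) rho : Prop :=
  fit_feasible lam P L' rho /\
  forall L'' rho', fit_feasible lam P L'' rho' ->
    fit_cost lam P L' rho <= fit_cost lam P L'' rho'.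

End DecayFit.

Section PossiblePairs.
Context {R : realType} {n m q o : nat}.
Variables (A : 'M[R]_n) (B : 'M[R]_(n, m)) (C : 'M[R]_(q, n)).
Variables (U : set 'cV[R]_m) (dbar0 : 'I_q -> R) (i : 'I_q) (p : nat).
Variable Psi : set 'cV[R]_(rdim m o p).

(* Since the noise-free regressors take their values in [Psi], the operating
   conditions that keep them there at every time are the possible ones. *)
Definition admissible (x : int -> 'cV[R]_n) (u : int -> 'cV[R]_m)
    (d : int -> 'cV[R]_q) : Prop :=
  [/\ trajectory A B x u, forall k, U (u k), noise_bounded dbar0 d
    & forall k, Psi (regressor p (perf C i x) u k)].

Definition possible_outputs (phi : 'cV[R]_(rdim m o p)) : set R :=
  [set yp | exists x u d k, [/\ admissible x u d,
     regressor p (meas C i x d) u k = phi & meas C i x d (k + p%:Z) = yp]].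

Definition possible_pairs : set 'cV[R]_(rdim m o p + 1) :=
  [set v | exists2 phi, noisy_regressors Psi (dbar0 i) phi &
           exists2 yp, possible_outputs phi yp & v = io_point phi yp].

End PossiblePairs.

(* Main.v *)
Require Import Defs.
From mathcomp Require Import all_boot all_order all_algebra.
From mathcomp Require Import all_classical all_reals all_analysis.
Import Order.TTheory GRing.Theory Num.Theory.
Import numFieldNormedType.Exports.
Local Open Scope classical_set_scope.
Local Open Scope ring_scope.
From mathcomp Require Import zify.

(** Iterating the one-step predictor on a signal that already obeys the model
reproduces the signal. Hence, with zero input, every simulated output [zh]
obeys for each horizon [p] the skip recursion
[zh (k + p) = \sum_(l < o) th_l * zh (k - l)], where [th] is the output part of
[hmap p theta1]. Membership in the decay set makes each [|th_l|] at most
[Lhat * rhohat ^+ p.+1] since [0 < rhohat < 1], so that [|zh (k + p)|] is at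
most [o * Lhat * rhohat ^+ p.+1] times the largest of the [|zh (k - l)|]. For
[p = pbar] this factor is smaller than 1: every value of [|zh|] is at most a
fixed fraction of the largest value over a window of fixed length that precedes
it, and such a sequence tends to zero geometrically, window after window
([cvg_window_contraction]). *)

(** One window length costs one factor [c]: by strong induction, the values from
[j * K] on are bounded by [c ^+ j] times the sum of the first [K] values. *)
Lemma cvg_window_contraction (R : realType) (K : nat) (c : R) (w : nat -> R) :
  0 <= c < 1 -> (0 < K)%N -> (forall s, 0 <= w s) ->
  (forall s b, (K <= s)%N -> (forall r, (s - K <= r < s)%N -> w r <= b) ->
     w s <= c * b) ->
  w @ \oo --> (0 : R).
Proof.
move=> /andP[c0 c1] K0 w0 wK; pose M : R := \sum_(s < K) w s.
have M0 : 0 <= M by apply: sumr_ge0.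
have wM s : w s <= M.
  elim/ltn_ind: s => s IH; have [sK|Ks] := ltnP s K.
    by rewrite /M (bigD1 (Ordinal sK)) //= lerDl sumr_ge0.
  apply: (@le_trans _ _ (c * M)); last by rewrite ler_piMl // ltW.
  by apply: wK => // r /andP[_]; apply: IH.
have wj j s : (j * K <= s)%N -> w s <= c ^+ j * M.
  elim: j s => [|j IH] s hs; first by rewrite expr0 mul1r.
  rewrite exprS -mulrA; apply: wK => [|r hr]; first by nia.
  by apply: IH; nia.
have gM : (fun j => c ^+ j * M) @ \oo --> (0 : R).
  rewrite -(mul0r M); apply: cvgM; last exact: cvg_cst.
  by apply: cvg_expr; rewrite ger0_norm.
apply/cvgr0Pnorm_lt => e e0.
have /cvgr0Pnorm_lt/(_ e e0)[J _ /(_ J (leqnn J)) HJ] := gM.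
exists (J * K)%N => // s /= hs.
rewrite ger0_norm //; apply: le_lt_trans (wj _ _ hs) _.
by apply: le_lt_trans HJ; rewrite ler_norm.
Qed.

Section FreeResponse.
Context {R : realType} {m o : nat}.
Implicit Types (th : 'cV[R]_(rdim m o 1)) (zh : int -> R).

(** Without input, the regressor contains only past outputs. *)
Lemma dot_regressor_free p zh k (v : 'cV[R]_(rdim m o p)) :
  dot (regressor p zh (fun=> 0) k) v
  = \sum_(l < o) usubmx v l 0 * zh (k - l%:Z).
Proof.
rewrite dotE big_split_ord /= [X in _ + X]big1 ?addr0 => [|l _].
  by apply: eq_bigr => l _; rewrite col_mxEu !mxE mulrC.
by rewrite col_mxEd !mxE mul0r.
Qed.

(** By induction on the horizon, each prediction starts from past values that
agree with those of [zh], and without input the prediction formula is the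
recursion that [zh] satisfies. *)
Lemma iter_pred_free th zh k p t : 0 <= k ->
  (forall k, 0 <= k ->
     zh (k + 1) = \sum_(l < o) usubmx th l 0 * zh (k - l%:Z)) ->
  iter_pred th zh (fun=> 0) k p t = zh t.
Proof.
move=> k0 Hzh; elim: p t => [//|p IH] t /=; case: eqP => [->|_]; last exact: IH.
have -> : regressor 1 (iter_pred th zh (fun=> 0) k p) (fun=> 0) (k + p%:Z)
          = regressor 1 zh (fun=> 0) (k + p%:Z) :> 'cV[R]_(rdim m o 1).
  by apply: regressor_eq.
by rewrite dot_regressor_free -Hzh; [congr zh|]; lia.
Qed.

(** As the same coefficients serve all times [k], this is again a linear
recursion, whose coefficients the decay set bounds. *)
Lemma free_response_skip th zh k p : 0 <= k -> (0 < p)%N ->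
  (forall k, 0 <= k ->
     zh (k + 1) = \sum_(l < o) usubmx th l 0 * zh (k - l%:Z)) ->
  zh (k + p%:Z) = \sum_(l < o) usubmx (hmap p th) l 0 * zh (k - l%:Z).
Proof.
move=> k0 p0 Hzh; rewrite -dot_regressor_free -predictionE //.
by rewrite /prediction iter_pred_free.
Qed.

(** Powers of [rho] decrease, so the bound on the first coefficient, with
exponent [p.+1], holds for all [o] of them. *)
Lemma decay_set_sum_le p (L rho b : R) (v : 'cV[R]_(rdim m o p))
    (f : 'I_o -> R) :
  0 <= L -> 0 <= rho <= 1 -> decay_set p L rho v -> (forall l, `|f l| <= b) ->
  `|\sum_(l < o) usubmx v l 0 * f l| <= o%:R * L * rho ^+ p.+1 * b.
Proof.
move=> L0 /andP[r0 r1] [vz _] fb; apply: le_trans (ler_norm_sum _ _ _) _.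
rewrite -!mulrA mulr_natl -[X in _ *+ X]card_ord -sumr_const mulrA.
apply: ler_sum => l _; rewrite normrM; apply: ler_pM => //.
apply: le_trans (vz l) _; apply: ler_wpM2l => //.
by apply: ler_wiXn2l => //; lia.
Qed.

(** The [p]-step recursion contracts in the maximum norm: the bounds on its [o]
coefficients sum to less than 1. This bounds [zh s] by the values at times
[s - p - o + 1, ..., s - p], all within the window of length [p + o] before
[s]. *)
Lemma decay_set_stable p (L rho : R) th :
  0 <= L -> 0 <= rho <= 1 -> (0 < p)%N -> o%:R * L * rho ^+ p.+1 < 1 ->
  decay_set p L rho (hmap p th) -> arx_stable th.
Proof.
move=> L0 r01 p0 c1 Hd zh Hzh; have /andP[r0 _] := r01.
(* The shift by [o] places the initial values at natural indices. *)
have Hw : (fun s : nat => `|zh (s%:Z - o%:Z)|) @ \oo --> (0 : R).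
  apply: (@cvg_window_contraction R (p + o) (o%:R * L * rho ^+ p.+1)).
  - by rewrite c1 andbT !mulr_ge0 // exprn_ge0.
  - by rewrite addn_gt0 p0.
  - by [].
  move=> s b hs Hb.
  have -> : s%:Z - o%:Z = (s%:Z - o%:Z - p%:Z) + p%:Z by lia.
  rewrite (free_response_skip th zh _ p _ p0 Hzh); last by lia.
  apply: decay_set_sum_le => // l.
  have -> : s%:Z - o%:Z - p%:Z - l%:Z = (s - p - l)%N%:Z - o%:Z.
    by have := ltn_ord l; lia.
  by apply: Hb; have := ltn_ord l; lia.
apply: norm_cvg0; move: Hw; rewrite -(cvg_shiftn o) /=.
by under eq_fun do rewrite PoszD addrK.
Qed.

End FreeResponse.

Theorem theorem3 (R : realType) (n m q o : nat)
  (A : 'M[R]_n) (B : 'M[R]_(n, m)) (C : 'M[R]_(q, n))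
  (x : int -> 'cV[R]_n) (u : int -> 'cV[R]_m) (d : int -> 'cV[R]_q)
  (U : set 'cV[R]_m) (dbar0 dbar : 'I_q -> R)
  (i : 'I_q)
  (Psi Omega : forall p : nat, set 'cV[R]_(rdim m o p))
  (N : nat) (lam : nat -> R) (delta : R) (pfit : nat)
  (L' Lhat rhohat : R) (pbar : nat) (theta1 : 'cV[R]_(rdim m o 1))
  (* the system and the assumptions on it *)
  (Htraj : trajectory A B x u)
  (Hstab : asymptotically_stable A B)
  (Hnoise : noise_bounded dbar0 d)
  (HU : compact U)
  (Hu : forall k, U (u k))
  (Hobs : observable A B C)
  (Hreach : reachable A B)
  (Horder : (n <= o)%N)
  (* the noise-free regressors *)
  (HPsi_compact : forall p, (1 <= p)%N -> compact (Psi p))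
  (HPsi : forall p, (1 <= p)%N ->
     forall k, Psi p (regressor p (perf C i x) u k))
  (* the data are informative in the limit *)
  (Hdata : forall p, (1 <= p)%N -> forall beta : R, 0 < beta ->
     exists N' : nat,
       (d2 (possible_pairs A B C U dbar0 i (Psi p))
           (data_set p (meas C i x d) u N') <= beta%:E)%E)
  (* the decay estimates *)
  (HOmega : forall p, (1 <= p)%N -> compact (Omega p))
  (Hlam : forall p, (1 <= p)%N ->
     is_min (error_bounds (Omega p) (data_set p (meas C i x d) u N) (dbar i))
            (lam p))
  (Hdelta : 0 < delta)
  (Hpfit : fit_horizon lam delta pfit)
  (Hfit : fit_optimal lam pfit L' rhohat)
  (HLhat_eq : Lhat = L' / (o%:R * dbar i))
  (HLhat_gt0 : 0 < Lhat)
  (* the chosen horizon and the tested parameter vector *)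
  (Hpbar : (2 <= pbar)%N)
  (Hcontr : o%:R * Lhat * rhohat ^+ pbar.+1 < 1)
  (Hdecay : forall p, (2 <= p <= pbar)%N ->
     decay_set p Lhat rhohat (hmap p theta1)) :
  arx_stable theta1.
Proof.
have [[_ _ /andP[r0 r1]] _] := Hfit.
apply: (@decay_set_stable _ _ _ pbar Lhat rhohat) => //.
- exact: ltW.
- by rewrite !ltW.
- exact: leq_trans Hpbar.
- by apply: Hdecay; rewrite Hpbar leqnn.
Qed.
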